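(* For integers $m\ge2$ and $t,n\ge1$ let $\mathsf{nwwnip}(m,t,n)$ be the number of web worlds $W$ whose set of pegs incident to at least one edge is exactly $\{1,\dots,m\}$, whose diagrams have exactly $t$ edges, and in which exactly $n$ distinct pairs of pegs are joined by at least one edge. Then, as formal power series, $$\sum_{m\ge2,\;t,n\ge1}\mathsf{nwwnip}(m,t,n)\,u^mz^ty^n=-\Big(\frac{u}{1+u}\Big)^2+\frac{1}{1+u}\sum_{m\ge2}\Big(1+\frac{yz}{1-z}\Big)^{\binom m2}\Big(\frac{u}{1+u}\Big)^m.$$
   Context: A web diagram with $L$ edges is a set $D=\{(x_j,y_j,a_j,b_j):1\le j\le L\}$ of distinct 4-tuples of positive integers with $x_j<y_j$ (edge from peg $x_j$ at height $a_j$ to peg $y_j$ at height $b_j$) such that for each peg $i$ the heights of the endpoints on peg $i$ are exactly $1,\dots,p_i$, where $p_i$ is the number of edge endpoints on peg $i$. The web world $W(D)$ is the set of all diagrams obtained from $D$ by permuting the heights independently on each peg. All diagrams of a web world have the same number of edges and the same numbers $a_{ij}$ ($i<j$) of edges joining pegs $i$ and $j$, and a web world is determined by these numbers; every choice of nonnegative integers $a_{ij}$ arises. *)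

(* Defs.v *)
From HB Require Import structures.
From mathcomp Require Import all_boot all_order all_algebra.
From mathcomp Require Import finmap.
From mathcomp Require Import boolp classical_sets functions cardinality.

Set Implicit Arguments.
Unset Strict Implicit.
Unset Printing Implicit Defensive.

Import GRing.Theory.

Local Open Scope ring_scope.

(* Univariate formal power series R[[X]].  The coefficient function is wrapped
   in a record because [nat -> R] already carries the pointwise product. *)
Record fps (R : Type) := FPS { fps_coef : nat -> R }.

HB.instance Definition _ (R : Type) := [isNew for @fps_coef R].
HB.instance Definition _ (R : choiceType) := [Choice of fps R by <:].

Lemma fpsP (R : Type) (f g : fps R) : fps_coef f =1 fps_coef g <-> f = g.
Proof.
split=> [|->//]; case: f g => [f] [g] /= fg.
by congr FPS; apply/funext.
Qed.

Section FpsZmodule.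
Variable R : zmodType.
Implicit Types f g h : fps R.

Definition fps_zero : fps R := FPS (fun=> 0).
Definition fps_opp f := FPS (fun n => - fps_coef f n).
Definition fps_add f g := FPS (fun n => fps_coef f n + fps_coef g n).

Fact fps_addA : associative fps_add.
Proof. by move=> f g h; apply/fpsP => n /=; rewrite addrA. Qed.
Fact fps_addC : commutative fps_add.
Proof. by move=> f g; apply/fpsP => n /=; rewrite addrC. Qed.
Fact fps_add0 : left_id fps_zero fps_add.
Proof. by move=> f; apply/fpsP => n /=; rewrite add0r. Qed.
Fact fps_addN : left_inverse fps_zero fps_opp fps_add.
Proof. by move=> f; apply/fpsP => n /=; rewrite addNr. Qed.

HB.instance Definition _ :=
  GRing.isZmodule.Build (fps R) fps_addA fps_addC fps_add0 fps_addN.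

End FpsZmodule.

Section FpsRing.
Variable R : comNzRingType.
Implicit Types f g h : fps R.

Definition fpsC (c : R) : fps R := FPS (fun n => if n == 0%N then c else 0).
Definition fpsX : fps R := FPS (fun n => (n == 1%N)%:R).
Definition fps_mul f g : fps R :=
  FPS (fun n => \sum_(i < n.+1) fps_coef f i * fps_coef g (n - i)%N).

Lemma fps_mul_poly f g n (p q : {poly R}) :
    (forall i, (i <= n)%N -> p`_i = fps_coef f i) ->
    (forall i, (i <= n)%N -> q`_i = fps_coef g i) ->
  fps_coef (fps_mul f g) n = (p * q)`_n.
Proof.
move=> pf qg; rewrite coefM; apply: eq_bigr => i _.
by rewrite pf ?qg ?leq_subr // -ltnS.
Qed.

Definition fps_trunc f n : {poly R} := \poly_(i < n.+1) fps_coef f i.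

Lemma coef_fps_trunc f n i : (i <= n)%N -> (fps_trunc f n)`_i = fps_coef f i.
Proof. by move=> lein; rewrite coef_poly ltnS lein. Qed.

Lemma coef_fps_truncM f g n i : (i <= n)%N ->
  (fps_trunc f n * fps_trunc g n)`_i = fps_coef (fps_mul f g) i.
Proof.
by move=> lein; apply/esym/fps_mul_poly => j leji;
  rewrite coef_fps_trunc // (leq_trans leji).
Qed.

Fact fps_mulA : associative fps_mul.
Proof.
move=> f g h; apply/fpsP => n.
rewrite (@fps_mul_poly _ _ n (fps_trunc f n) (fps_trunc g n * fps_trunc h n)).
- rewrite (@fps_mul_poly _ _ n (fps_trunc f n * fps_trunc g n) (fps_trunc h n)).
  + by rewrite mulrA.
  + by move=> i; apply: coef_fps_truncM.
  + by move=> i; apply: coef_fps_trunc.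
- by move=> i; apply: coef_fps_trunc.
- by move=> i; apply: coef_fps_truncM.
Qed.

Fact fps_mulC : commutative fps_mul.
Proof.
by move=> f g; apply/fpsP => n; rewrite -!(@coef_fps_truncM _ _ n n) // mulrC.
Qed.

Fact fps_mul1 : left_id (fpsC 1) fps_mul.
Proof.
move=> f; apply/fpsP => n /=; rewrite big_ord_recl /= subn0 mul1r.
by rewrite big1 ?addr0 // => i _; rewrite mul0r.
Qed.

Fact fps_mulDl : left_distributive fps_mul +%R.
Proof.
move=> f g h; apply/fpsP => n /=; rewrite -big_split /=.
by apply: eq_bigr => i _; rewrite mulrDl.
Qed.

Fact fps_one_neq0 : fpsC 1 != 0.
Proof.
by apply/eqP => /fpsP/(_ 0%N) /= /eqP; apply/negP; exact: oner_neq0.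
Qed.

HB.instance Definition _ := GRing.Zmodule_isComNzRing.Build (fps R)
  fps_mulA fps_mulC fps_mul1 fps_mulDl fps_one_neq0.

End FpsRing.

Section FpsUnit.
Variable R : comUnitRingType.
Implicit Types f g : fps R.

Definition fps_unit : {pred fps R} :=
  fun f => fps_coef f 0%N \is a GRing.unit.

(* The first [n] coefficients of [f^-1], obtained by solving [f^-1 * f = 1]
   degree by degree. *)
Fixpoint fps_inv_seq f n : seq R :=
  if n is k.+1 then
    let s := fps_inv_seq f k in
    rcons s ((fps_coef f 0%N)^-1
             * ((k == 0%N)%:R - \sum_(i < k) s`_i * fps_coef f (k - i)%N))
  else [::].

Definition fps_inv f : fps R :=
  if f \in fps_unit then FPS (fun n => (fps_inv_seq f n.+1)`_n) else f.

Lemma size_fps_inv_seq f n : size (fps_inv_seq f n) = n.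
Proof. by elim: n => //= n IHn; rewrite size_rcons IHn. Qed.

Lemma nth_fps_inv_seq f n i : (i < n)%N ->
  (fps_inv_seq f n)`_i = (fps_inv_seq f i.+1)`_i.
Proof.
elim: n => // n IHn; rewrite ltnS leq_eqVlt => /predU1P[-> //|ltin].
by rewrite [LHS]/= nth_rcons size_fps_inv_seq ltin IHn.
Qed.

Fact fps_mulVx : {in fps_unit, left_inverse 1 fps_inv *%R}.
Proof.
move=> f Uf; apply/fpsP => n; rewrite /fps_inv Uf.
rewrite [LHS]/= big_ord_recr /= subnn.
rewrite nth_rcons size_fps_inv_seq ltnn eqxx.
under eq_bigr => i _.
  rewrite -[rcons _ _]/(fps_inv_seq f i.+1).
  rewrite -(@nth_fps_inv_seq f n i) //.
  over.
rewrite mulrC mulrA mulrV // mul1r addrC subrK.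
by case: (n == 0%N).
Qed.

Fact fps_unitPl f g : g * f = 1 -> fps_unit f.
Proof.
move=> /fpsP/(_ 0%N); rewrite /= big_ord_recl big_ord0 addr0 /= => gf.
by apply/unitrPr; exists (fps_coef g 0%N); rewrite mulrC.
Qed.

Fact fps_inv_out : {in [predC fps_unit], fps_inv =1 id}.
Proof. by move=> f; rewrite inE /= /fps_inv => /negbTE ->. Qed.

HB.instance Definition _ := GRing.ComNzRing_hasMulInverse.Build (fps R)
  fps_mulVx fps_unitPl fps_inv_out.

End FpsUnit.

(* Z[[u, z, y]], realised as Z[[y]][[z]][[u]]. *)
Notation fps3 := (fps (fps (fps int))).

Definition fps3_coef (f : fps3) (m t n : nat) : int :=
  fps_coef (fps_coef (fps_coef f m) t) n.

(* The series with coefficient [c m t n] at u^m z^t y^n. *)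
Definition mk_fps3 (c : nat -> nat -> nat -> int) : fps3 :=
  FPS (fun m => FPS (fun t => FPS (fun n => c m t n))).

Definition var_u : fps3 := fpsX (fps (fps int)).
Definition var_z : fps3 := fpsC (fpsX (fps int)).
Definition var_y : fps3 := fpsC (fpsC (fpsX int)).

(* Convergence of formal power series: every coefficient is eventually
   constant, equal to the corresponding coefficient of the limit. *)
Definition fps3_cvg (F : nat -> fps3) (S : fps3) : Prop :=
  forall m t n, exists N0, forall N, (N0 <= N)%N ->
    fps3_coef (F N) m t n = fps3_coef S m t n.

Lemma fps3P (f g : fps3) :
  (forall m t n, fps3_coef f m t n = fps3_coef g m t n) -> f = g.
Proof.
move=> fg; apply/fpsP => m; apply/fpsP => t; apply/fpsP => n; exact: fg.
Qed.

Lemma fps3_cvg_unique F S S' : fps3_cvg F S -> fps3_cvg F S' -> S = S'.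
Proof.
move=> FS FS'; apply: fps3P => m t n.
have [N SN] := FS m t n; have [N' SN'] := FS' m t n.
by rewrite -(SN (maxn N N')) ?leq_maxl // -(SN' (maxn N N')) ?leq_maxr.
Qed.

Local Open Scope nat_scope.
Local Open Scope fset_scope.
Local Open Scope classical_set_scope.

(* (x, y, a, b): an edge from peg x at height a to peg y at height b. *)
Definition edge := (nat * nat * nat * nat)%type.
Definition lpeg (e : edge) : nat := e.1.1.1.
Definition rpeg (e : edge) : nat := e.1.1.2.
Definition lheight (e : edge) : nat := e.1.2.
Definition rheight (e : edge) : nat := e.2.

(* The list, with multiplicities, of the heights of the edge endpoints lying
   on peg i; its size is p_i. *)
Definition heights (D : {fset edge}) (i : nat) : seq nat :=
  [seq lheight e | e <- D & lpeg e == i]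
  ++ [seq rheight e | e <- D & rpeg e == i].

Definition num_endpoints (D : {fset edge}) (i : nat) : nat :=
  size (heights D i).

Definition web_diagram (D : {fset edge}) : Prop :=
  (forall e, e \in D ->
     [/\ 0 < lpeg e, 0 < lheight e, 0 < rheight e & lpeg e < rpeg e])
  /\ (forall i, perm_eq (heights D i) (iota 1 (num_endpoints D i))).

(* [s i] is the permutation applied to the heights on peg i. *)
Definition permute_heights (s : nat -> nat -> nat) (D : {fset edge}) :
    {fset edge} :=
  [fset (lpeg e, rpeg e, s (lpeg e) (lheight e), s (rpeg e) (rheight e))
     | e in D].

Definition web_world (D : {fset edge}) : set {fset edge} :=
  [set D' | exists s : nat -> nat -> nat,
     (forall i, let H := [set h | 1 <= h <= num_endpoints D i] in
        set_bij H H (s i))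
     /\ D' = permute_heights s D].

Definition is_web_world (W : set {fset edge}) : Prop :=
  exists D, web_diagram D /\ W = web_world D.

Definition pegs (D : {fset edge}) : {fset nat} :=
  ([fset lpeg e | e in D] `|` [fset rpeg e | e in D])%fset.

Definition joined_pairs (D : {fset edge}) : {fset nat * nat} :=
  [fset (lpeg e, rpeg e) | e in D].

Definition web_worlds (m t n : nat) : set (set {fset edge}) :=
  [set W | is_web_world W /\
     forall D, W D ->
       [/\ forall i, (i \in pegs D) = (1 <= i <= m),
           #|` D| = t & #|` joined_pairs D| = n]].

Definition nwwnip (m t n : nat) : nat := #|` fset_set (web_worlds m t n)|.

Lemma web_world_refl D : web_world D D.
Proof.
exists (fun _ h => h); split=> [i H|].
  by split=> [//|//|h Hh]; exists h.
apply/fsetP => e; apply/idP/imfsetP => [eD|[e' /= e'D ->]].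
  by exists e => //; move: e {eD} => [[[x y] a] b].
by move: e' e'D => [[[x y] a] b].
Qed.

(* [fset_set] is a junk value on infinite sets, so this is what makes [nwwnip]
   a genuine count. *)
Lemma finite_web_worlds m t n : finite_set (web_worlds m t n).
Proof.
pose r := [fset i | i in iota 0 (maxn m (2 * t)).+1]%fset.
pose box := (((r `*` r) `*` r) `*` r)%fset.
apply: (@sub_finite_set _ _ (web_world @` [set` fpowerset box])); last first.
  exact/finite_image/finite_fset.
move=> W [[D [[Dpos Dperm] ->]] /(_ D (web_world_refl D))[Dpegs Dt _]].
exists D => //=; rewrite fpowersetE; apply/fsubsetP => e eD.
have inr i : i <= maxn m (2 * t) -> i \in r.
  by move=> lei; apply/imfsetP; exists i; rewrite // mem_iota.
have height_le i h : h \in heights D i -> h <= 2 * t.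
  move=> hD; move: (hD); rewrite (perm_mem (Dperm i)) mem_iota add1n ltnS.
  case/andP=> _ /leq_trans; apply.
  rewrite /num_endpoints size_cat !size_map !size_filter mul2n -addnn -Dt.
  by rewrite leq_add // count_size.
have peg_le i : i \in pegs D -> i <= m by rewrite Dpegs => /andP[].
rewrite /box !in_fsetM; apply/andP; split; [apply/andP; split; [apply/andP; split|]|].
- apply: inr; apply: leq_trans (leq_maxl _ _); apply: peg_le; rewrite inE.
  by apply/orP; left; apply/imfsetP; exists e.
- apply: inr; apply: leq_trans (leq_maxl _ _); apply: peg_le; rewrite inE.
  by apply/orP; right; apply/imfsetP; exists e.
- apply: inr; apply: leq_trans (leq_maxr _ _); apply: (height_le (lpeg e)).
  by rewrite mem_cat; apply/orP; left; apply: map_f; rewrite mem_filter eqxx.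
- apply: inr; apply: leq_trans (leq_maxr _ _); apply: (height_le (rpeg e)).
  by rewrite mem_cat; apply/orP; right; apply: map_f; rewrite mem_filter eqxx.
Qed.

Definition nwwnip_series : fps3 :=
  mk_fps3 (fun m t n => if [&& 2 <= m, 1 <= t & 1 <= n]
                        then Posz (nwwnip m t n) else 0%R).

(* Main.v *)
(** A web world is determined by its peg-pair multiplicities: two diagrams with
    the same multiset of peg pairs differ by reordering the heights on each peg,
    and every multiset of pairs [x < y] is realised by adding edges on top one
    at a time.  Hence [nwwnip m t n] counts the multigraphs on [m] vertices with
    [t] edges, [n] joined pairs and no isolated vertex.  Without the last
    condition, the multigraphs supported on a vertex set [A] are counted by
    [(1 + yz/(1-z)) ^ 'C(#|A|, 2)], one factor per pair; inclusion-exclusion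
    over [A] gives the signed sum over [k] of ['C(m, k)] times the [k]-th power,
    and [u ^ k / (1 + u) ^ (k + 1)] is the series with coefficients
    [(-1) ^ (m + k) * 'C(m, k)].  The terms [k = 0, 1] of the resulting sum
    account for the correction [- (u / (1 + u)) ^ 2]. *)

Require Import Defs.
From mathcomp Require Import all_boot all_order all_algebra finmap.
From mathcomp Require Import zify ring.
From mathcomp Require Import boolp classical_sets functions cardinality.

Set Implicit Arguments.
Unset Strict Implicit.
Unset Printing Implicit Defensive.

(** * Web worlds are classified by the multiset of their peg pairs *)

Section WebWorlds.

Local Open Scope nat_scope.

Definition peg_pair (e : edge) : nat * nat := (lpeg e, rpeg e).

Definition permute_edge (s : nat -> nat -> nat) (e : edge) : edge :=
  (lpeg e, rpeg e, s (lpeg e) (lheight e), s (rpeg e) (rheight e)).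

Lemma mem_permute_heights s (D : {fset edge}) :
  permute_heights s D =i map (permute_edge s) D.
Proof.
by move=> e; apply/imfsetP/mapP => -[e' e'D ->]; exists e'.
Qed.

Definition heights_seq (r : seq edge) (i : nat) : seq nat :=
  [seq lheight e | e <- r & lpeg e == i]
  ++ [seq rheight e | e <- r & rpeg e == i].

Lemma perm_heights_seq (r1 r2 : seq edge) i :
  perm_eq r1 r2 -> perm_eq (heights_seq r1 i) (heights_seq r2 i).
Proof. by move=> r12; rewrite perm_cat // perm_map // perm_filter. Qed.

Lemma size_heights_seq (r : seq edge) i :
  size (heights_seq r i) = count (fun p => p.1 == i) (map peg_pair r)
                           + count (fun p => p.2 == i) (map peg_pair r).
Proof. by rewrite size_cat !size_map !size_filter !count_map. Qed.

Lemma num_endpoints_perm (D D' : {fset edge}) i :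
  perm_eq (map peg_pair D) (map peg_pair D') ->
  num_endpoints D i = num_endpoints D' i.
Proof.
move=> DD'; rewrite /num_endpoints !(size_heights_seq (enum_fset _)).
by rewrite !(permP DD').
Qed.

Lemma mem_lheight (D : {fset edge}) e :
  e \in D -> lheight e \in heights D (lpeg e).
Proof.
by move=> eD; rewrite mem_cat; apply/orP; left; apply: map_f;
  rewrite mem_filter eqxx.
Qed.

Lemma mem_rheight (D : {fset edge}) e :
  e \in D -> rheight e \in heights D (rpeg e).
Proof.
by move=> eD; rewrite mem_cat; apply/orP; right; apply: map_f;
  rewrite mem_filter eqxx.
Qed.

Lemma mem_heights (D : {fset edge}) i h :
  web_diagram D -> (h \in heights D i) = (1 <= h <= num_endpoints D i).
Proof.
by case=> _ /(_ i)/perm_mem ->; rewrite mem_iota add1n ltnS.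
Qed.

(** Permuting heights keeps every edge on its pegs. The only danger is that two edges collide in the
    image set; this is excluded because each [s i] is injective on the heights present on peg
    [i]. *)
Lemma perm_peg_pair_web_world D D' :
  web_diagram D -> web_world D D' -> perm_eq (map peg_pair D') (map peg_pair D).
Proof.
move=> wD [s [s_bij ->]].
have s_inj i : {in heights D i &, injective (s i)}.
  move=> h h' Dh Dh' shh'; have [_ inj_s _] := s_bij i.
  by apply: inj_s => //; rewrite inE /= -mem_heights.
have g_inj : {in D &, injective (permute_edge s)}.
  move=> [[[x y] a] b] [[[x' y'] a'] b'] eD eD' [ex ey].
  rewrite /lpeg /rpeg /= in ex ey; subst x' y' => ea eb.
  have -> : a = a'.
    exact: (s_inj x _ _ (mem_lheight eD) (mem_lheight eD') ea).
  have -> // : b = b'.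
  exact: (s_inj y _ _ (mem_rheight eD) (mem_rheight eD') eb).
have permD : perm_eq (permute_heights s D) (map (permute_edge s) D).
  apply: uniq_perm (mem_permute_heights s D); first exact: fset_uniq.
  by rewrite map_inj_in_uniq // fset_uniq.
by rewrite (perm_trans (perm_map peg_pair permD)) // -map_comp.
Qed.

(** Glues an agreement of heights known peg by peg into an agreement along the whole edge list. It
    serves left and right endpoints alike. *)
Lemma map_peg_heights (peg height : edge -> nat) (s : nat -> nat -> nat)
    (r1 r2 : seq edge) :
    map peg r1 = map peg r2 ->
    (forall i, map (s i) [seq height e | e <- r1 & peg e == i]
               = [seq height e | e <- r2 & peg e == i]) ->
  [seq s (peg e) (height e) | e <- r1] = map height r2.
Proof.
elim: r1 r2 => [|e1 r1 IH] [|e2 r2] //= [e12 r12] sh.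
congr cons; first by have := sh (peg e1); rewrite -e12 eqxx /= => -[].
apply: IH => // i; have := sh i; rewrite -e12; by case: ifP => //= _ [].
Qed.

(** List the edges of [D'] in an order [D2] whose peg pairs match those of [D] position by position.
    On each peg, matching endpoints in this order defines the permutation of heights that carries
    [D] to [D']. *)
Lemma web_world_of_perm D D' :
    web_diagram D -> web_diagram D' ->
    perm_eq (map peg_pair D') (map peg_pair D) ->
  web_world D D'.
Proof.
move=> wD wD' DD'.
have [Is IsP defD] : exists2 Is, perm_eq Is (iota 0 (size D'))
    & map peg_pair D = map (nth (0, 0) (map peg_pair D')) Is.
  have := DD'; rewrite perm_sym => /(perm_iotaP (0, 0)).
  by rewrite size_map.
pose D2 := map (nth (0, 0, 0, 0) D') Is.
have permD2 : perm_eq D2 D'.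
  by apply/(perm_iotaP (0, 0, 0, 0)); exists Is.
have pegD2 : map peg_pair D = map peg_pair D2.
  rewrite defD -map_comp; apply/eq_in_map => k.
  by rewrite (perm_mem IsP) mem_iota /= => ltk; rewrite (nth_map (0, 0, 0, 0)).
have pegl : map lpeg D = map lpeg D2.
  by have := congr1 (map fst) pegD2; rewrite -!map_comp.
have pegr : map rpeg D = map rpeg D2.
  by have := congr1 (map snd) pegD2; rewrite -!map_comp.
have sizeh i : size (heights_seq D i) = size (heights_seq D2 i).
  by rewrite !size_heights_seq pegD2.
have uniqh i : uniq (heights_seq D i).
  by case: wD => _ /(_ i)/perm_uniq ->; rewrite iota_uniq.
have memh i h : (h \in heights_seq D i) = (1 <= h <= num_endpoints D i).
  exact: mem_heights.
have memh2 i h : (h \in heights_seq D2 i) = (1 <= h <= num_endpoints D i).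
  rewrite (perm_mem (perm_heights_seq i permD2)) mem_heights //.
  by rewrite (num_endpoints_perm i DD').
have uniqh2 i : uniq (heights_seq D2 i).
  rewrite (perm_uniq (perm_heights_seq i permD2)).
  by case: wD' => _ /(_ i)/perm_uniq ->; rewrite iota_uniq.
(* The [k]-th height on peg [i] in [D] goes to the [k]-th one in [D2]; both lists enumerate the same
   interval without repetition. *)
pose s i h := nth 0 (heights_seq D2 i) (index h (heights_seq D i)).
have mapsh i : map (s i) (heights_seq D i) = heights_seq D2 i.
  apply: (@eq_from_nth _ 0); rewrite size_map // => k ltk.
  by rewrite (nth_map 0) // /s index_uniq.
have smem i h : h \in heights_seq D i -> s i h \in heights_seq D2 i.
  by move=> hD; rewrite -mapsh map_f.
exists s; split=> [i H|].
  rewrite {}/H; split=> [h|h h'|h] /=.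
  - by rewrite -memh -memh2; exact: smem.
  - rewrite !inE /= -!memh => hD h'D /eqP.
    rewrite nth_uniq // -?sizeh ?index_mem // => /eqP.
    by move=> hh'; rewrite -(nth_index 0 hD) hh' nth_index.
  - rewrite -memh2 -mapsh => /mapP[h' h'D ->]; exists h' => //.
    by rewrite -memh.
(* Equal lengths of the left halves allow the identity [mapsh] between concatenations to be split
   into left and right endpoints. *)
have szl i : size (map (s i) [seq lheight e | e <- D & lpeg e == i])
             = size [seq lheight e | e <- D2 & lpeg e == i].
  rewrite !size_map !size_filter.
  by have := congr1 (count (pred1 i)) pegl; rewrite !count_map.
have shl i : map (s i) [seq lheight e | e <- D & lpeg e == i]
             = [seq lheight e | e <- D2 & lpeg e == i].
  have /eqP := mapsh i; rewrite map_cat eqseq_cat ?szl //.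
  by case/andP => /eqP.
have shr i : map (s i) [seq rheight e | e <- D & rpeg e == i]
             = [seq rheight e | e <- D2 & rpeg e == i].
  have /eqP := mapsh i; rewrite map_cat eqseq_cat ?szl //.
  by case/andP => _ /eqP.
have hl := map_peg_heights pegl shl.
have hr := map_peg_heights pegr shr.
have mapD : map (permute_edge s) D = D2.
  move: hl hr pegl pegr; rewrite -/(permute_edge s); clearbody s.
  elim: (enum_fset D) (D2) => [|[[[x y] a] b] r IH] [|[[[x' y'] a'] b'] r'] //=.
  move=> [ea ra] [eb rb] [ex rx] [ey ry].
  rewrite (IH r') //; congr cons; rewrite /permute_edge /=.
  by move: ea eb ex ey; rewrite /lpeg /rpeg /lheight /rheight /= => -> -> -> ->.
apply/fsetP => e; rewrite -(perm_mem permD2) -mapD.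
by rewrite mem_permute_heights.
Qed.

(** [D'] is itself a height permutation of [D], and height permutations compose peg by peg. *)
Lemma web_world_sub D D' :
    web_diagram D -> web_diagram D' ->
    perm_eq (map peg_pair D') (map peg_pair D) ->
  (web_world D' `<=` web_world D)%classic.
Proof.
move=> wD wD' DD' X [s [s_bij ->]].
have [s0 [s0_bij D'E]] := web_world_of_perm wD wD' DD'.
exists (fun i => s i \o s0 i); split=> [i H|].
  have := s_bij i; rewrite (num_endpoints_perm i DD').
  exact: set_bij_comp (s0_bij i).
apply/fsetP => e; rewrite {1}D'E.
apply/imfsetP/imfsetP => [[e' /imfsetP[e2 /= e2D ->] ->]|[e2 /= e2D ->]].
  by exists e2.
by exists (permute_edge s0 e2) => //; apply: (in_imfset _ (permute_edge s0)).
Qed.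

Lemma web_world_eqP D D' : web_diagram D -> web_diagram D' ->
  web_world D = web_world D' <-> perm_eq (map peg_pair D) (map peg_pair D').
Proof.
move=> wD wD'; split=> [WW|DD'].
  by apply: perm_peg_pair_web_world => //; rewrite -WW; exact: web_world_refl.
by apply/seteqP; split; apply: web_world_sub => //; rewrite perm_sym.
Qed.

(** By induction on [l]: a new edge is placed above everything already on its two pegs, which
    extends each of the two height intervals by one. *)
Lemma web_diagram_exists (l : seq (nat * nat)) :
    all (fun p => 0 < p.1 < p.2) l ->
  exists2 D, web_diagram D & perm_eq (map peg_pair D) l.
Proof.
elim: l => [_|[x y] l IH /= /andP[/andP[x_gt0 ltxy] /IH[D wD Dl]]].
  by exists fset0 => //; split.
pose px := num_endpoints D x; pose py := num_endpoints D y.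
pose e : edge := (x, y, px.+1, py.+1).
(* Its left height exceeds every height on peg [x]. *)
have eND : e \notin D.
  apply/negP => /mem_lheight; rewrite mem_heights //= /lheight /lpeg /=.
  by rewrite ltnn.
have permeD : perm_eq (e |` D)%fset (e :: D).
  apply: uniq_perm; rewrite ?fset_uniq //= ?eND ?fset_uniq //.
  by move=> e'; rewrite !inE.
exists (e |` D)%fset; last first.
  by rewrite (perm_trans (perm_map peg_pair permeD)) //= perm_cons.
split=> [e'|i].
  rewrite !inE => /predU1P[->|/(proj1 wD) //].
  by split.
have permh := perm_heights_seq i permeD.
rewrite /num_endpoints (perm_size permh) (perm_trans permh) //.
have hD := proj2 wD i; rewrite /num_endpoints in hD.
have iotaS : iota 1 (size (heights D i)).+1
    = rcons (iota 1 (size (heights D i))) (num_endpoints D i).+1.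
  by rewrite -[(size _).+1]addn1 iotaD -cats1 addnC.
rewrite /heights_seq /= -[lpeg e]/x -[rpeg e]/y.
(* Since [x < y], the new edge has at most one endpoint on peg [i]. *)
case: eqVneq => [xi|_]; case: eqVneq => [yi|_].
- by move: ltxy; rewrite xi yi ltnn.
- rewrite -[iota 1 _]/(iota 1 (size (heights D i)).+1) iotaS.
  by rewrite perm_sym perm_rcons perm_sym /lheight /= /px xi perm_cons.
- rewrite size_cat /= addnS -size_cat.
  rewrite -[iota 1 _]/(iota 1 (size (heights D i)).+1) iotaS.
  rewrite perm_sym perm_rcons perm_sym /rheight /= /py yi.
  by rewrite (perm_catCA _ [:: _] _) perm_cons.
- by [].
Qed.


Lemma peg_pairs_stats (D : {fset edge}) (l : seq (nat * nat)) :
    perm_eq (map peg_pair D) l ->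
  [/\ forall i, (i \in pegs D) = has (fun p => (p.1 == i) || (p.2 == i)) l,
      #|` D| = size l & #|` joined_pairs D| = size (undup l)].
Proof.
move=> Dl; split=> [i||].
- rewrite -(perm_has _ Dl) has_map inE.
  apply/orP/hasP => [[] /imfsetP[e /= eD ->]|[e eD /orP[]/eqP <-]].
  + by exists e => //=; rewrite eqxx.
  + by exists e => //=; rewrite eqxx orbT.
  + by left; apply: in_imfset.
  + by right; apply: in_imfset.
- by rewrite -(perm_size Dl) size_map.
- apply: perm_size; apply: uniq_perm; rewrite ?fset_uniq ?undup_uniq // => p.
  rewrite mem_undup -(perm_mem Dl).
  by apply/imfsetP/mapP => -[e eD ->]; exists e.
Qed.

(** * Counting web worlds as multigraphs without isolated vertices *)

Section Multigraphs.
Variables m t : nat.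
Implicit Types f : {ffun 'I_m * 'I_m -> 'I_t.+1}.

(* [f p] is the number of edges joining the pegs [p.1.+1] and [p.2.+1]; with
   [t] edges in total no multiplicity exceeds [t]. *)
Definition multigraphs n : {set {ffun 'I_m * 'I_m -> 'I_t.+1}} :=
  [set f : {ffun 'I_m * 'I_m -> 'I_t.+1} |
    [&& \sum_p f p == t, #|[set p | 0 < f p]| == n
      & [forall p, (0 < f p) ==> (p.1 < p.2)]]].

Definition covered f : {set 'I_m} :=
  [set i | [exists p, (0 < f p) && ((p.1 == i) || (p.2 == i))]].

Definition peg_pair_of (p : 'I_m * 'I_m) : nat * nat := (p.1.+1, p.2.+1).

Definition pair_list f : seq (nat * nat) :=
  flatten [seq nseq (f p) (peg_pair_of p) | p <- enum {: 'I_m * 'I_m}].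

Lemma peg_pair_of_inj : injective peg_pair_of.
Proof. by move=> [i j] [k l] [ik jl]; congr (_, _); apply: val_inj. Qed.

Lemma count_pair_list f (a : pred (nat * nat)) :
  count a (pair_list f) = \sum_p a (peg_pair_of p) * f p.
Proof.
rewrite count_flatten -map_comp sumnE big_map big_enum /=.
by apply: eq_bigr => p _; rewrite count_nseq.
Qed.

Lemma size_pair_list f : size (pair_list f) = \sum_p f p.
Proof.
by rewrite -count_predT count_pair_list; apply: eq_bigr => p _; rewrite mul1n.
Qed.

Lemma count_mem_pair_list f p :
  count_mem (peg_pair_of p) (pair_list f) = f p.
Proof.
rewrite count_pair_list (bigD1 p) //= eqxx mul1n big1 ?addn0 // => q neqp.
by rewrite (inj_eq peg_pair_of_inj) (negbTE neqp).
Qed.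

Lemma pair_listP f x :
  reflect (exists2 p, 0 < f p & x = peg_pair_of p) (x \in pair_list f).
Proof.
apply: (iffP flatten_mapP) => [[p _]|[p fp ->]].
  by rewrite mem_nseq => /andP[fp /eqP ->]; exists p.
by exists p; rewrite ?mem_enum // mem_nseq fp eqxx.
Qed.

Lemma size_undup_pair_list f :
  size (undup (pair_list f)) = #|[set p | 0 < f p]|.
Proof.
rewrite cardE -(size_map peg_pair_of); apply: perm_size; apply: uniq_perm.
- exact: undup_uniq.
- by rewrite (map_inj_uniq peg_pair_of_inj) enum_uniq.
move=> x; rewrite mem_undup; apply/pair_listP/mapP => -[p fp ->]; exists p => //.
  by rewrite mem_enum inE.
by move: fp; rewrite mem_enum inE.
Qed.

Lemma has_pair_list f i :
  has (fun p => (p.1 == i) || (p.2 == i)) (pair_list f)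
  = [exists j : 'I_m, (j \in covered f) && (j.+1 == i)].
Proof.
apply/hasP/existsP => [[_ /pair_listP[p fp ->]] /= pi|[j /andP[]]].
  case/orP: pi => pi; [exists p.1|exists p.2]; rewrite pi andbT inE;
    by apply/existsP; exists p; rewrite fp eqxx ?orbT.
rewrite inE => /existsP[p /andP[fp pj]] /eqP <-.
exists (peg_pair_of p); first by apply/pair_listP; exists p.
by rewrite /= !eqSS; case/orP: pj => /eqP ->; rewrite eqxx ?orbT.
Qed.

Lemma covered_setTP f :
  reflect (forall i, has (fun p => (p.1 == i) || (p.2 == i)) (pair_list f)
                     = (1 <= i <= m))
          (covered f == [set: 'I_m]).
Proof.
apply: (iffP eqP) => [fT i|fT].
  rewrite has_pair_list fT; apply/existsP/andP => [[j /andP[_ /eqP <-]]|].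
    by rewrite ltn_ord.
  by case: i => [[]|i [_ ltim]] //; exists (Ordinal ltim); rewrite inE /=.
apply/setP => j; rewrite [RHS]inE; have := fT j.+1.
rewrite has_pair_list ltn_ord => /existsP[k /andP[fk]].
by rewrite eqSS => /eqP/val_inj <-.
Qed.

Lemma perm_pair_list f (l : seq (nat * nat)) :
    (forall p, f p = count_mem (peg_pair_of p) l :> nat) ->
    {subset l <= codom peg_pair_of} ->
  perm_eq (pair_list f) l.
Proof.
move=> fl lcod; apply/allP => x _ /=; apply/eqP.
have [/codomP[p ->]|xN] := boolP (x \in codom peg_pair_of).
  by rewrite count_mem_pair_list fl.
rewrite (count_memPn (_ : x \notin l)); last by apply: contra xN; exact: lcod.
apply/count_memPn; apply: contra xN => /pair_listP[p _ ->]; exact: codom_f.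
Qed.

(** Sending a multigraph to the web world of a diagram realising it is a bijection: multiplicities
    can be recovered from the multiset of peg pairs, and any diagram of a given web world supplies a
    preimage. *)
Lemma nwwnip_multigraphs n :
  nwwnip m t n = #|[set f in multigraphs n | covered f == [set: 'I_m]]|.
Proof.
(* Outside [multigraphs n] the chosen diagram is arbitrary. *)
have /choice[Df DfP] f : exists D, f \in multigraphs n ->
    web_diagram D /\ perm_eq (map peg_pair D) (pair_list f).
  have [fG|//] := boolP (f \in multigraphs n); last by exists fset0.
  have [|D wD Df] := @web_diagram_exists (pair_list f); last by exists D.
  apply/allP => _ /pair_listP[p fp ->] /=; rewrite ltnS.
  by move: fG; rewrite inE => /and3P[_ _ /forallP/(_ p)]; rewrite fp.
set G := [set f in _ | _].
pose FG : {fset {ffun 'I_m * 'I_m -> 'I_t.+1}} := [fset f in G]%fset.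
have memFG f : (f \in FG) = (f \in G) by rewrite inE.
pose W f := web_world (Df f).
have -> : #|G| = #|` FG| by rewrite card_finset.
have W_inj : {in FG &, injective W}.
  move=> f g; rewrite !memFG !inE -!andbA => /and4P[f1 f2 f3 _] /and4P[g1 g2 g3 _].
  have fG : f \in multigraphs n by rewrite inE f1 f2.
  have gG : g \in multigraphs n by rewrite inE g1 g2.
  have [wf pf] := DfP f fG; have [wg pg] := DfP g gG.
  move/(web_world_eqP wf wg) => fg; apply/ffunP => p; apply: val_inj => /=.
  rewrite -!count_mem_pair_list -(permP pf) -(permP pg).
  exact: (permP fg).
rewrite /nwwnip; suff -> : web_worlds m t n = [set W f | f in [set` FG]]%classic.
  by apply/eqP; rewrite fset_set_image // set_fsetK; apply/card_in_imfsetP.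
apply/seteqP; split=> [_ [[D [wD ->]] DP]|_ [f /= fFG <-]]; last first.
  move: fFG; rewrite memFG inE => /andP[fG /covered_setTP fT].
  have [wf pf] := DfP f fG; split; first by exists (Df f).
  move=> D /(perm_peg_pair_web_world wf) pD.
  have [pegD -> ->] := peg_pairs_stats (perm_trans pD pf).
  move: fG; rewrite inE => /and3P[/eqP ft /eqP fn _].
  split=> [i||]; first by rewrite pegD fT.
    by rewrite size_pair_list.
  by rewrite size_undup_pair_list.
have [pegD Dt Dn] := DP D (web_world_refl D).
set l := map peg_pair D.
have [pegl sizel undupl] := peg_pairs_stats (perm_refl l).
have lt_l p : p \in l -> [/\ 0 < p.1, p.1 < p.2 & p.2 <= m].
  case/mapP => e eD ->; have [l_gt0 _ _ lt_lr] := proj1 wD e eD.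
  split=> //=; have : rpeg e \in pegs D.
    by rewrite inE (_ : _ \in [fset rpeg e | e in D]%fset) ?orbT // in_imfset.
  by rewrite pegD => /andP[].
(* [inord] does not truncate here: a multiplicity is at most the size of [l], which is [t]. *)
pose f := [ffun p => inord (count_mem (peg_pair_of p) l)]
  : {ffun 'I_m * 'I_m -> 'I_t.+1}.
have fE p : f p = count_mem (peg_pair_of p) l :> nat.
  by rewrite ffunE inordK // ltnS -Dt sizel count_size.
have fl : perm_eq (pair_list f) l.
  apply: (perm_pair_list fE) => -[x y] /lt_l /= [x_gt0 ltxy leym].
  (* Pegs are numbered from 1, vertices of the multigraph from 0. *)
  have ltx : x.-1 < m by rewrite prednK // (leq_trans (ltnW ltxy)).
  have y_gt0 := leq_trans x_gt0 (ltnW ltxy).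
  have lty : y.-1 < m by rewrite prednK.
  by apply/codomP; exists (Ordinal ltx, Ordinal lty); rewrite /peg_pair_of /= !prednK.
have fG : f \in multigraphs n.
  rewrite inE -size_pair_list (perm_size fl) -sizel Dt eqxx /=.
  rewrite -size_undup_pair_list (perm_size (perm_undup (perm_mem fl))).
  rewrite -undupl Dn eqxx /=; apply/forallP => p; apply/implyP.
  by rewrite fE -has_count has_pred1 => /lt_l[].
exists f.
  rewrite /= memFG inE fG /=; apply/covered_setTP => i.
  by rewrite (perm_has _ fl) -pegl pegD.
have [wf pf] := DfP f fG.
by apply/(web_world_eqP wf wD); exact: perm_trans fl.
Qed.

End Multigraphs.

End WebWorlds.

(** * Coefficients of formal power series *)

Section FpsCoef.

Local Open Scope ring_scope.
Import GRing.Theory.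

Variable R : comNzRingType.
Implicit Types f g : fps R.

Lemma fps_coef1 n : fps_coef (1 : fps R) n = (n == 0%N)%:R.
Proof. by rewrite /=; case: eqP. Qed.

Lemma fps_coefD f g n : fps_coef (f + g) n = fps_coef f n + fps_coef g n.
Proof. by []. Qed.

Lemma fps_coefB f g n : fps_coef (f - g) n = fps_coef f n - fps_coef g n.
Proof. by []. Qed.

Lemma fps_coef_sum (I : Type) (r : seq I) (P : pred I) (F : I -> fps R) n :
  fps_coef (\sum_(i <- r | P i) F i) n = \sum_(i <- r | P i) fps_coef (F i) n.
Proof. exact: (big_morph (fun f => fps_coef f n)). Qed.

Lemma fps_coef_mulC c f n : fps_coef (fpsC c * f) n = c * fps_coef f n.
Proof.
rewrite /= big_ord_recl /= subn0 big1 ?addr0 // => i _.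
by rewrite mul0r.
Qed.

Lemma fps_coef_mulX f n :
  fps_coef (fpsX R * f) n = if n is k.+1 then fps_coef f k else 0.
Proof.
case: n => [|n]; first by rewrite /= big_ord_recl big_ord0 /= mul0r addr0.
rewrite /= !big_ord_recl /= big1 => [|i _]; last by rewrite mul0r.
by rewrite mul0r mul1r add0r addr0 subSS subn0.
Qed.

Lemma fps_coefXn k n : fps_coef (fpsX R ^+ k) n = (n == k)%:R.
Proof.
elim: k n => [|k IHk] n; first by rewrite expr0 fps_coef1.
by rewrite exprS fps_coef_mulX; case: n => [|n] //; rewrite IHk.
Qed.

Lemma fpsCD : {morph @fpsC R : a b / a + b}.
Proof. by move=> a b; apply/fpsP => -[|n] //=; rewrite addr0. Qed.

Lemma fpsCN : {morph @fpsC R : a / - a}.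
Proof. by move=> a; apply/fpsP => -[|n] //=; rewrite oppr0. Qed.

Lemma fpsCM : {morph @fpsC R : a b / a * b}.
Proof.
move=> a b; apply/fpsP => n; rewrite fps_coef_mulC.
by case: n => [|n] //=; rewrite mulr0.
Qed.

Lemma fpsC_exp k : {morph @fpsC R : a / a ^+ k}.
Proof. by move=> a; elim: k => // k IHk; rewrite !exprS fpsCM IHk. Qed.

(** Only coefficients up to degree [t] matter, so the factors may be truncated to polynomials and
    the product expanded by distributivity; [f i] is the degree of the monomial picked from factor
    [i]. *)
Lemma fps_coef_prod (I : finType) (F : I -> fps R) t :
  fps_coef (\prod_i F i) t
  = \sum_(f : {ffun I -> 'I_t.+1} | (\sum_i f i)%N == t)
      \prod_i fps_coef (F i) (f i).
Proof.
(* All [k] up to [t] are treated at once, since each product coefficient involves the lower ones. *)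
have trunc k : (k <= t)%N ->
    (\prod_i fps_trunc (F i) t)`_k = fps_coef (\prod_i F i) k.
  elim/big_rec2: _ k => [|i p f _ IH] k lekt.
    by rewrite coef1 fps_coef1.
  apply/esym/fps_mul_poly => j lejk.
    by rewrite coef_fps_trunc // (leq_trans lejk).
  by rewrite IH // (leq_trans lejk).
rewrite -trunc //.
under eq_bigr do rewrite /fps_trunc poly_def.
rewrite bigA_distr_bigA coef_sum [RHS]big_mkcond /=.
apply: eq_bigr => f _; rewrite scaler_prod prodrXr coefZ coefXn eq_sym.
by case: eqP => _; rewrite ?mulr1 ?mulr0.
Qed.

End FpsCoef.

(** * The expansion of [u ^ k / (1 + u) ^ (k + 1)] *)

Section AlternatingBinomialSeries.

Local Open Scope ring_scope.
Import GRing.Theory.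

Variable R : comUnitRingType.

Definition alt_binomial_series (k : nat) : fps R :=
  FPS (fun m => (-1) ^+ (m + k) * 'C(m, k)%:R).

Lemma fps_unit1X : (1 + fpsX R) \is a GRing.unit.
Proof. by rewrite -[_ \is a _]/(1 + 0 \is a GRing.unit) addr0 unitr1. Qed.

(** Induction on [k] after multiplying by [1 + X]: Pascal's rule with alternating signs cancels all
    but a shift of the previous series. *)
Lemma alt_binomial_seriesE k :
  alt_binomial_series k = (1 + fpsX R)^-1 * (fpsX R / (1 + fpsX R)) ^+ k.
Proof.
have U := fps_unit1X.
elim: k => [|k IHk]; apply: (mulrI U).
  rewrite expr0 mulr1 divrr //; apply/fpsP => n.
  rewrite mulrDl mul1r fps_coefD fps_coef_mulX fps_coef1.
  case: n => [|n] /=; first by rewrite addr0 mul1r.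
  by rewrite !bin0 !mulr1 !addn0 exprS mulN1r addNr.
rewrite exprS mulVKr // -mulrA -IHk; apply/fpsP => n.
rewrite mulrDl mul1r fps_coefD !fps_coef_mulX.
case: n => [|n] /=; first by rewrite bin0n mulr0 addr0.
rewrite binS natrD !addnS addSn !exprS !mulN1r opprK.
by rewrite mulrDr addrAC mulNr subrr add0r.
Qed.

End AlternatingBinomialSeries.

(** * Inclusion-exclusion over the set of covered vertices *)

Section MultigraphCount.

Local Open Scope ring_scope.
Import GRing.Theory.

(* [1 + yz/(1-z)] as a series in [z]: the weight [y] is paid once per joined
   pair, whatever the positive number of edges. *)
Definition pair_series : fps (fps int) :=
  FPS (fun j => if j == 0%N then 1 else fpsX int).

(** Increasing pairs, decreasing pairs and the diagonal make up the square of [A], so twice the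
    cardinal plus [#|A|] equals [#|A| * #|A|]. *)
Lemma card_ltn_pairs m (A : {set 'I_m}) :
  #|[set p : 'I_m * 'I_m | [&& (p.1 < p.2)%N, p.1 \in A & p.2 \in A]]|
  = 'C(#|A|, 2).
Proof.
have bin2_double k : (k + 'C(k, 2).*2 = k * k)%N.
  by elim: k => // k; rewrite binS bin1; lia.
set L := [set p | _].
have cardL : #|L| = (\sum_(i in A) \sum_(j in A) (i < j))%N.
  rewrite pair_big_dep /= -sum1_card big_mkcond [RHS]big_mkcond /=.
  by apply: eq_bigr => p _; rewrite inE; case: ltnP; case: (p.1 \in A); case: (p.2 \in A).
apply: double_inj; apply: (@addnI #|A|); rewrite bin2_double -addnn.
rewrite {1}cardL cardL {2}exchange_big /= -{1}sum1_card -!big_split /=.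
rewrite -sum_nat_const; apply: eq_bigr => i iA.
rewrite -big_split /= -[1%N](_ : (\sum_(j in A) (j == i) = 1)%N); last first.
  by rewrite (bigD1 i) //= eqxx big1 // => j /andP[_ /negbTE ->].
rewrite -big_split /= -sum1_card; apply: eq_bigr => j _.
by rewrite -val_eqE /=; case: ltngtP.
Qed.

(** The support condition becomes a constraint on each pair separately, so that the count can factor
    over pairs. *)
Lemma multigraphs_covered_subset m t n (A : {set 'I_m}) f :
  (f \in multigraphs m t n) && (covered f \subset A)
  = [&& (\sum_p f p)%N == t, #|[set p | (0 < f p)%N]| == n
     & [forall p, (0 < f p)%N ==> [&& (p.1 < p.2)%N, p.1 \in A & p.2 \in A]]].
Proof.
rewrite inE -!andbA; congr [&& _, _ & _].
apply/andP/forallP => [[/forallP flt /fintype.subsetP fA] p|fA].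
  apply/implyP => fp; rewrite (implyP (flt p)) //=.
  by rewrite !fA // inE; apply/existsP; exists p; rewrite fp eqxx ?orbT.
split.
  by apply/forallP => p; apply/implyP => /(implyP (fA p))/andP[].
apply/fintype.subsetP => i; rewrite inE => /existsP[p /andP[fp]].
by have /and3P[_ A1 A2] := implyP (fA p) fp; case/orP=> /eqP <-.
Qed.

(** Expand a product over all ordered pairs with factor [pair_series] on the admissible ones and 1
    elsewhere. A function [f] contributes [y] to the size of its support, or 0 if it charges a pair
    that is not admissible. *)
Lemma coef_pair_series_exp m t n (A : {set 'I_m}) :
  fps_coef (fps_coef (pair_series ^+ 'C(#|A|, 2)) t) n
  = #|[set f in multigraphs m t n | covered f \subset A]|%:R.
Proof.
pose E := [set p : 'I_m * 'I_m | [&& (p.1 < p.2)%N, p.1 \in A & p.2 \in A]].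
rewrite -card_ltn_pairs -/E.
have -> : pair_series ^+ #|E| = \prod_p (if p \in E then pair_series else 1).
  by rewrite -big_mkcond prodr_const.
rewrite fps_coef_prod fps_coef_sum -sum1_card natr_sum big_mkcond.
rewrite [RHS]big_mkcond; apply: eq_bigr => f _ /=.
rewrite inE multigraphs_covered_subset; case: eqP => //= _.
have -> : \prod_p fps_coef (if p \in E then pair_series else 1) (f p)
  = if [forall p, (0 < f p)%N ==> (p \in E)]
    then fpsX int ^+ #|[set p | (0 < f p)%N]| else 0.
  case: ifPn => [/forallP fE|/forallPn[p] /=].
    rewrite -prodr_const [RHS]big_mkcond; apply: eq_bigr => p _.
    rewrite inE; have := fE p; rewrite lt0n.
    by have [->|fp /= ->] := eqVneq (f p : nat) 0%N; [case: ifP | rewrite /= (negbTE fp)].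
  rewrite negb_imply lt0n => /andP[fp /negbTE pE].
  rewrite (bigD1 p) //= pE fps_coef1 (negbTE fp) mul0r //.
under eq_forallb => p do rewrite inE.
case: ifP => fE; last by rewrite andbF.
by rewrite andbT fps_coefXn eq_sym; case: eqP.
Qed.

(** Both sides equal the product over [i] of [1 - [i \notin B]]. In its expansion, where [A]
    collects the indices contributing 1, a set [A] that misses an element of [B] gives 0, and any
    other gives the sign of its complement. *)
Lemma sum_supersets_sign m (B : {set 'I_m}) :
  \sum_(A : {set 'I_m} | B \subset A) (-1) ^+ (m + #|A|)
  = (B == [set: 'I_m])%:R :> int.
Proof.
transitivity (\prod_(i < m) (1 + - (i \notin B)%:R) : int); last first.
  have [->|neqBT] := eqVneq B [set: 'I_m].
    by rewrite big1 // => i _; rewrite inE subr0.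
  have [i iB] : exists i, i \notin B.
    apply/existsP; apply: contraR neqBT; rewrite negb_exists => /forallP BT.
    by apply/eqP/setP => i; rewrite inE; exact/negPn/BT.
  by rewrite (bigD1 i) //= iB subrr mul0r.
rewrite bigA_distr big_mkcond; apply: eq_bigr => A _ /=.
rewrite (bigID (mem A)) /= big1 ?mul1r => [|i ->//].
case: ifPn => [/fintype.subsetP sBA|/fintype.subsetPn[i iB iA]]; last first.
  by rewrite (bigD1 i) //= (negbTE iA) iB oppr0 mul0r.
transitivity (\prod_(i in ~: A) (-1) : int).
  rewrite prodr_const -signr_odd -[RHS]signr_odd -[m in (m + _)%N]card_ord.
  by rewrite -(cardsC A) !oddD addbAC addbb.
apply: eq_big => [i|i]; first by rewrite inE.
by rewrite inE => iA; rewrite (negbTE iA) (contra (sBA i)).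
Qed.

(** Sum the signed counts of multigraphs covered by [A] over all [A]. Exchanging the sums leaves
    only the multigraphs covering everything, and grouping by the cardinal of [A] yields the
    binomials. *)
Lemma card_spanning_multigraphs m t n :
  #|[set f in multigraphs m t n | covered f == [set: 'I_m]]|%:R
  = \sum_(k < m.+1) (-1) ^+ (m + k) * 'C(m, k)%:R
      * fps_coef (fps_coef (pair_series ^+ 'C(k, 2)) t) n :> int.
Proof.
have natr_card (T : finType) (S : {set T}) : #|S|%:R = \sum_(x in S) 1 :> int.
  by rewrite -sum1_card natr_sum.
transitivity (\sum_(A : {set 'I_m}) (-1) ^+ (m + #|A|)
    * fps_coef (fps_coef (pair_series ^+ 'C(#|A|, 2)) t) n).
  under [RHS]eq_bigr => A _ do
    rewrite coef_pair_series_exp natr_card mulr_sumr.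
  rewrite (exchange_big_dep (mem (multigraphs m t n))) /=; last first.
    by move=> A f _; rewrite inE => /andP[].
  transitivity (\sum_(f in multigraphs m t n)
      (covered f == [set: 'I_m])%:R : int).
    rewrite natr_card (eq_bigl (fun f => (f \in multigraphs m t n)
      && (covered f == [set: 'I_m]))); last by move=> f; rewrite finset.in_set.
    by rewrite big_mkcondr; apply: eq_bigr => f _; case: eqP.
  apply: eq_bigr => f fG; rewrite -sum_supersets_sign.
  by apply: eq_big => [A|A _]; rewrite ?mulr1 // finset.in_set fG.
(* [inord] is exact because [#|A| <= m]. *)
rewrite (partition_big (fun A : {set 'I_m} => inord #|A| : 'I_m.+1) predT) //=.
apply: eq_bigr => k _.
transitivity (\sum_(A in [set A : {set 'I_m} | #|A| == k])
   (-1) ^+ (m + k) * fps_coef (fps_coef (pair_series ^+ 'C(k, 2)) t) n).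
  apply: eq_big => [A|A /eqP <-].
    by rewrite inE -val_eqE /= inordK // ltnS -[m in (_ <= m)%N]card_ord max_card.
  by rewrite inordK // ltnS -[m in (_ <= m)%N]card_ord max_card.
by rewrite sumr_const card_draws card_ord -mulrA mulr_natl -mulrnAr.
Qed.

End MultigraphCount.

(** * Assembling the generating function *)

Section GeneratingFunction.

Local Open Scope ring_scope.
Import GRing.Theory.

Lemma fps_coef_sign_natr_mul (R : comNzRingType) a b (f : fps R) n :
  fps_coef ((-1) ^+ a * b%:R * f) n = (-1) ^+ a * b%:R * fps_coef f n.
Proof.
rewrite -!mulrA !mulr_natl -[in LHS]signr_odd -[in RHS]signr_odd.
have coefMn : fps_coef (f *+ b) n = fps_coef f n *+ b.
  by elim: b => // b IHb; rewrite !mulrS fps_coefD IHb.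
by case: odd; rewrite ?expr1 ?expr0 ?mulN1r ?mul1r -coefMn.
Qed.

(** The first vertex must be covered, which forces an edge and hence a joined pair. *)
Lemma nwwnip_eq0 m t n : (0 < m)%N -> ~~ ((0 < t)%N && (0 < n)%N) ->
  nwwnip m t n = 0%N.
Proof.
case: m => // m _ tn0; rewrite nwwnip_multigraphs; apply/eqP; rewrite cards_eq0.
apply/eqP/setP => f; rewrite !inE; apply/negbTE; apply: contra tn0.
case/andP => /and3P[_ /eqP fn _] /eqP/setP/(_ ord0).
rewrite !inE => /existsP[p /andP[fp _]].
rewrite -fn card_gt0; apply/andP; split.
  by rewrite -ltnS (leq_ltn_trans fp).
by apply/set0Pn; exists p; rewrite inE.
Qed.

(** After multiplication by [1 - z] the claim is that [(pair_series - 1) * (1 - z)] telescopes to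
    [y * z]. *)
Lemma var_pair_series : 1 + var_y * var_z / (1 - var_z) = fpsC pair_series.
Proof.
have Uz : 1 - var_z \is a GRing.unit.
  (* Invertibility is read off the constant term, first in [u], then in [z]. *)
  rewrite -[_ \is a _]/(1 - fpsX (fps int) \is a GRing.unit).
  rewrite -[_ \is a _]/(1 - 0 \is a GRing.unit).
  by rewrite subr0 unitr1.
rewrite -[RHS](subrK 1) [RHS]addrC; congr (1 + _).
apply: (mulIr Uz); rewrite mulrVK //.
have -> : 1 = fpsC 1 :> fps3 by [].
rewrite /var_y /var_z -!(@fpsCN (fps (fps int))) -!fpsCD -!fpsCM; congr fpsC.
apply/fpsP => j; rewrite fps_coef_mulC.
rewrite mulrBr mulr1 [_ * fpsX _]mulrC fps_coefB fps_coef_mulX.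
case: j => [|[|j]]; rewrite ?fps_coefB ?fps_coef1 /= ?mulr0 ?mulr1 ?subr0 ?subrr //.
by rewrite subr0.
Qed.

Definition spanning_series : fps3 :=
  FPS (fun m => \sum_(k < m.+1)
         (-1) ^+ (m + k) * 'C(m, k)%:R * pair_series ^+ 'C(k, 2)).

Lemma coef_spanning_series m t n :
  fps3_coef spanning_series m t n = (nwwnip m t n)%:R.
Proof.
rewrite nwwnip_multigraphs card_spanning_multigraphs /fps3_coef !fps_coef_sum.
by apply: eq_bigr => k _; rewrite !fps_coef_sign_natr_mul.
Qed.

(** The subtracted 1 is the empty web world on no pegs; a single peg contributes nothing. *)
Lemma nwwnip_seriesE : nwwnip_series = spanning_series - 1.
Proof.
have coef0 : fps_coef spanning_series 0 = 1.
  by rewrite /= big_ord_recl big_ord0 addr0 !mul1r.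
have coef1 : fps_coef spanning_series 1 = 0.
  rewrite /= !big_ord_recl big_ord0 addr0 /= !bin0 !binn !expr0 !mulr1.
  by rewrite sqrrN expr1n expr1 addNr.
apply: fps3P => m t n; rewrite {2}/fps3_coef !fps_coefB.
case: m => [|[|m]].
- by rewrite coef0 fps_coef1 subrr.
- by rewrite coef1 fps_coef1 subr0.
rewrite -[fps_coef (fps_coef (fps_coef spanning_series _) t) n]
  /(fps3_coef spanning_series m.+2 t n).
rewrite coef_spanning_series /= subr0 /fps3_coef /=.
case: ifPn => [_|tn0]; first by rewrite -natz.
by rewrite nwwnip_eq0.
Qed.

(** Since ['C(j, k)] vanishes for [k > j], the range of summation can be made independent of [j]. *)
Lemma coef_spanning_series_wide (j N : nat) : (j < N)%N ->
  fps_coef spanning_series j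
  = \sum_(0 <= k < N) fps_coef (fpsC (pair_series ^+ 'C(k, 2))
                                * alt_binomial_series _ k) j.
Proof.
move=> ltjN; under [RHS]eq_bigr do rewrite fps_coef_mulC.
rewrite (big_cat_nat _ (n := j.+1)) //= [X in _ + X]big_nat_cond.
rewrite [X in _ + X]big1 ?addr0 => [|k /andP[/andP[ltjk _] _]].
  rewrite big_mkord; apply: eq_bigr => k _.
  by rewrite mulrC.
by rewrite (bin_small ltjk) !mulr0.
Qed.

(** Isolates [k = 0] and [k = 1], where ['C(k, 2) = 0] makes the pair factor 1. *)
Lemma coef_spanning_series_split (j N : nat) : (j < N)%N -> (1 < N)%N ->
  fps_coef spanning_series j
  = fps_coef (alt_binomial_series _ 0) j + (fps_coef (alt_binomial_series _ 1) j
    + fps_coef (\sum_(2 <= k < N) fpsC (pair_series ^+ 'C(k, 2))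
                                   * alt_binomial_series _ k) j).
Proof.
move=> ltjN lt1N; rewrite (coef_spanning_series_wide ltjN).
rewrite fps_coef_sum (big_ltn (ltnW lt1N)) (big_ltn lt1N).
by congr (_ + (_ + _)); apply: (congr1 (fun f => fps_coef f j)); exact: mul1r.
Qed.

Lemma add_add_sub_sub (V : zmodType) (a b c : V) : a + (b + c) - a - b = c.
Proof. by rewrite [a + _]addrC addrK [b + c]addrC addrK. Qed.

(** Applied with [v = 1 / (1 + u)], so that [1 - v = u / (1 + u)]: removing the terms [k = 0, 1]
    amounts to subtracting 1 and adding the square. *)
Lemma sub1_sqr_complement (R : comNzRingType) (a v : R) :
  a - 1 + (1 - v) ^+ 2 = a - v * (1 - v) ^+ 0 - v * (1 - v) ^+ 1.
Proof. by ring. Qed.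

End GeneratingFunction.

Local Open Scope ring_scope.

Theorem theorem4p4 :
  exists S : fps3,
    fps3_cvg
      (fun N => \sum_(2 <= m < N)
         (1 + var_y * var_z / (1 - var_z)) ^+ 'C(m, 2)
         * (var_u / (1 + var_u)) ^+ m) S
    /\ nwwnip_series
       = - (var_u / (1 + var_u)) ^+ 2 + (1 + var_u)^-1 * S.
Proof.
have U : 1 + var_u \is a GRing.unit by exact: fps_unit1X.
set q := var_u / (1 + var_u).
have qE : q = 1 - (1 + var_u)^-1.
  apply: (GRing.mulIr U); rewrite GRing.mulrVK // GRing.mulrBl GRing.mulVr //.
  by rewrite GRing.mul1r [1 + var_u]GRing.addrC GRing.addrK.
have term k : fpsC pair_series ^+ 'C(k, 2) * q ^+ k = (1 + var_u) *
    (fpsC (pair_series ^+ 'C(k, 2)) * alt_binomial_series _ k).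
  rewrite alt_binomial_seriesE -/var_u -/q fpsC_exp GRing.mulrCA.
  by rewrite GRing.mulVKr.
(* The identity determines [S]; solving it for [S] leaves only the convergence to prove. *)
exists ((1 + var_u) * (nwwnip_series + q ^+ 2)); split; last first.
  by rewrite GRing.mulKr // GRing.addrC GRing.addrK.
(* The bound [m.+2] ensures both [m < N], so that no omitted term reaches [u ^ m], and [1 < N],
   needed to split off [k = 0, 1]. *)
move=> m t n; exists m.+2 => N leN; rewrite /fps3_coef var_pair_series.
congr (fps_coef (fps_coef _ _) _).
under eq_bigr do rewrite term.
rewrite -GRing.mulr_sumr.
have eq_coef j : (j <= m)%N ->
    fps_coef (\sum_(2 <= k < N) fpsC (pair_series ^+ 'C(k, 2))
                                * alt_binomial_series _ k) j
    = fps_coef (nwwnip_series + q ^+ 2) j.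
  move=> lejm; have ltjN : (j < N)%N by rewrite (leq_trans _ leN) // ltnS ltnW.
  have -> : nwwnip_series + q ^+ 2
      = spanning_series - alt_binomial_series _ 0 - alt_binomial_series _ 1.
    rewrite nwwnip_seriesE !alt_binomial_seriesE -/var_u -/q qE.
    exact: sub1_sqr_complement.
  rewrite !fps_coefB (coef_spanning_series_split ltjN) ?(leq_trans _ leN) //.
  exact/esym/add_add_sub_sub.
(* The factor [1 + u] brings in the coefficients of degrees [m] and [m - 1]. *)
rewrite !GRing.mulrDl !GRing.mul1r !fps_coefD !fps_coef_mulX eq_coef //.
case: m leN eq_coef => // m leN eq_coef; by rewrite eq_coef.
Qed.
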